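(* Let $\ell\ge 1$. For every arrival sequence $\mathbf{b}\in B_\ell$, the color-blind equivalence class $\mathcal{C}(\mathbf{b})=\{\mathbf{a}\in B_\ell:\vec{r}(\mathbf{a})=\vec{r}(\mathbf{b})\}$ has an even number of elements.
   Context: An arrival sequence of length $\ell$ is a binary string $\mathbf{b}=b_1b_2\cdots b_\ell\in\{0,1\}^\ell$; $B_\ell$ is the set of all of them. Cars $1,2,\dots,\ell$ arrive in order and choose between two initially empty lanes (left and right): if $b_i=0$, car $i$ enters the right lane; if $b_i=1$, car $i$ enters the currently shorter lane, and enters the right lane if both lanes have the same length. The right lane vector $\vec{r}(\mathbf{b})$ is the increasing list of indices $i$ of the cars that enter the right lane. Two arrival sequences $\mathbf{a},\mathbf{b}\in B_\ell$ are color-blind equivalent if $\vec{r}(\mathbf{a})=\vec{r}(\mathbf{b})$. *)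

(* Defs.v *)
From mathcomp Require Import all_boot.

Set Implicit Arguments.
Unset Strict Implicit.
Unset Printing Implicit Defensive.

(* An arrival sequence of length l is an l.-tuple bool, with true for the bit 1
   and false for the bit 0; its entry at position i : 'I_l is the bit b_(i.+1)
   of car i.+1. *)

(* Each lane lists its cars in order of arrival. *)
Record lanes := Lanes { left_lane : seq nat; right_lane : seq nat }.

(* On a tie, the strict comparison sends the car to the right lane. *)
Definition enter (s : lanes) (car : nat * bool) : lanes :=
  let: (i, bi) := car in
  if bi && (size (left_lane s) < size (right_lane s))
  then Lanes (rcons (left_lane s) i) (right_lane s)
  else Lanes (left_lane s) (rcons (right_lane s) i).

Definition park (b : seq bool) : lanes :=
  foldl enter (Lanes [::] [::]) (zip (iota 1 (size b)) b).

Definition right_lane_vector (b : seq bool) : seq nat := right_lane (park b).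

Definition color_blind_equiv (l : nat) (a b : l.-tuple bool) : bool :=
  right_lane_vector a == right_lane_vector b.

Definition color_blind_class (l : nat) (b : l.-tuple bool) :
    {set l.-tuple bool} :=
  [set a : l.-tuple bool | color_blind_equiv a b].

(* Main.v *)
(* The first car finds two empty lanes, so it enters the right lane whatever
   its bit: flipping that bit is an involution without fixed points that
   preserves every color-blind equivalence class. *)
Require Import Defs.
From mathcomp Require Import all_boot.

(** The predicate [p] cuts [A] into two parts that [f] exchanges, so they have equal size. *)
Lemma even_card_involution (T : finType) (A : {set T}) (f : T -> T)
    (p : pred T) :
  involutive f -> (forall x, (f x \in A) = (x \in A)) ->
  (forall x, p (f x) = ~~ p x) -> ~~ odd #|A|.
Proof.
move=> fK fA pf; rewrite -(cardsID [set x | p x] A).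
suff -> : A :\: [set x | p x] = f @: (A :&: [set x | p x]).
  by rewrite (card_imset _ (inv_inj fK)) addnn odd_double.
(* Writing [x] as [f (f x)] turns membership in the image into a condition on [f x]. *)
apply/setP=> x; rewrite -{2}[x]fK (mem_imset _ _ (inv_inj fK)).
by rewrite !inE fA pf andbC.
Qed.

Lemma right_lane_vector_cons (x y : bool) (s : seq bool) :
  right_lane_vector (x :: s) = right_lane_vector (y :: s).
(* Both lanes have size 0, so the first bit is conjoined with a false comparison. *)
Proof. by rewrite /right_lane_vector /park /= !andbF. Qed.

Definition flip_first {n : nat} (t : n.+1.-tuple bool) : n.+1.-tuple bool :=
  [tuple of ~~ thead t :: behead t].

Lemma flip_firstK (n : nat) : involutive (@flip_first n).
Proof. by case/tupleP=> x t; apply: val_inj; rewrite /= !theadE negbK. Qed.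

Lemma right_lane_vector_flip_first (n : nat) (t : n.+1.-tuple bool) :
  right_lane_vector (flip_first t) = right_lane_vector t.
Proof. by case/tupleP: t => x t; apply: right_lane_vector_cons. Qed.

Theorem proposition6p1 (l : nat) (hl : 1 <= l) (b : l.-tuple bool) :
  ~~ odd #|color_blind_class b|.
Proof.
case: l hl b => // n _ b.
(* The first bit itself separates the two halves of the class. *)
apply: (@even_card_involution _ _ flip_first (@thead n bool)).
- exact: flip_firstK.
- by move=> a; rewrite !inE /color_blind_equiv right_lane_vector_flip_first.
- by move=> a; rewrite theadE.
Qed.
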